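(* For every integer $k\ge 2$ there is a constant $C=C(k)>0$, and for every integer $k\geq 2$ and every real $0<\epsilon<1$ there is $N_0=N_0(k,\epsilon)$, such that the following holds. Suppose that $G$ is a finite abelian group of order at least $N_0$, and that $A\subseteq G$ is $k$-stable. Then there exists a Bohr set $B\subseteq G$ of width at least $\epsilon^{C}$ and rank at most $\epsilon^{-C}$ such that for any $g\in G$, either $|(A-g)\cap B|\leq \epsilon |B|$ or $|B\setminus (A-g)|\leq \epsilon|B|$.
   Context: Stability: for a group $G$ (written additively), $A\subseteq G$ and an integer $k\geq 2$, the set $A$ has the $k$-order property if there exist $a_1,\dots,a_k,b_1,\dots,b_k\in G$ such that $a_i+b_j\in A$ if and only if $i\leq j$. The set $A$ is $k$-stable if it does not have the $k$-order property. Bohr sets: for a finite abelian group $G$, let $\widehat{G}$ be the group of characters of $G$ (homomorphisms from $G$ to $\{z\in\mathbb{C}:|z|=1\}$). For $K\subseteq\widehat{G}$ and $\rho\in[0,1]$, the Bohr set with frequency set $K$ and width $\rho$ is $B(K,\rho)=\{x\in G: |\gamma(x)-1|\leq\rho \text{ for all }\gamma\in K\}$; $|K|$ is called its rank. (Width and rank refer to the chosen presentation $(K,\rho)$; in particular $B(\emptyset,\rho)=G$.) Notation: $A-g=\{a-g:a\in A\}$. *)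

(* Defs.v *)
From HB Require Import structures.
From mathcomp Require Import all_boot all_order all_algebra.
From mathcomp Require Import finmap complex.
From mathcomp Require Import reals exp.

Set Implicit Arguments.
Unset Strict Implicit.
Unset Printing Implicit Defensive.

Import Order.TTheory GRing.Theory Num.Theory.
Local Open Scope ring_scope.

(* Indices are shifted from {1, ..., k} to {0, ..., k-1}. *)
Definition order_property (G : finZmodType) (k : nat) (A : {set G}) : Prop :=
  exists a b : 'I_k -> G, forall i j : 'I_k, a i + b j \in A <-> (i <= j)%N.

Definition stable (G : finZmodType) (k : nat) (A : {set G}) : Prop :=
  ~ order_property k A.

Definition translate (G : finZmodType) (A : {set G}) (g : G) : {set G} :=
  [set a - g | a in A].

(* Homomorphisms from the additive group G to the multiplicative group of
   complex numbers of modulus 1. *)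
Definition is_character (R : realType) (G : finZmodType)
    (f : {ffun G -> R[i]}) : bool :=
  [forall x, forall y, f (x + y) == f x * f y] && [forall x, `|f x| == 1].

Record character (R : realType) (G : finZmodType) := Character {
  charfun :> {ffun G -> R[i]};
  _ : is_character charfun }.

HB.instance Definition _ (R : realType) (G : finZmodType) :=
  [isSub for @charfun R G].
HB.instance Definition _ (R : realType) (G : finZmodType) :=
  [Choice of character R G by <:].

(* The norm of R[i] is R[i]-valued, hence the embedding rho%:C. *)
Definition bohr (R : realType) (G : finZmodType)
    (K : {fset character R G}) (rho : R) : {set G} :=
  [set x | [forall gamma : K, `|val gamma x - 1| <= (rho%:C)%C]].

(* Main.v *)
Require Import Defs.
From HB Require Import structures.
From mathcomp Require Import all_boot all_order all_algebra.
From mathcomp Require Import finmap complex.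
From mathcomp Require Import reals exp.
From mathcomp Require Import separable cyclotomic lra zify.

Set Implicit Arguments.
Unset Strict Implicit.
Unset Printing Implicit Defensive.

Import Order.TTheory GRing.Theory Num.Theory.
Local Open Scope ring_scope.

(* The Bohr set can be taken to be a subgroup H of polynomially bounded index,
   cut out by one character per nontrivial coset.  Stability bounds the height h
   of binary trees whose nodes split G into A - t and its complement.  Hence
   repeatedly splitting G must stop at some X which every A - g almost contains
   or almost misses; the admissible errors are chosen so that the error at X is
   much smaller than any fixed power of the density of X.  Let D be the set of g
   for which A - g almost contains X, and let H be the exact stabiliser of D.  If
   t is not in H then A and A + t differ on at least |X|/2 points, and a family of
   translates separated by d|G| has size less than (4/d)^h, since a larger one
   would produce a tree of height h; so H has bounded index.  On the part X' of X
   in its most popular coset the error is still small, and averaging over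
   g in g0 + H, a set which D contains or misses, shows that every coset of H is
   almost contained in A or almost disjoint from it. *)

(** * Binary trees and ladders *)

Definition nbh (S T : finType) (E : S -> T -> bool) (t : T) : {set S} :=
  [set s | E s t].

(* [X] carries a full binary tree of height [n] whose nodes are labelled by
   [t] in [Y], branching on [E ^~ t], with all leaves nonempty. *)
Fixpoint splits (S T : finType) (E : S -> T -> bool) (n : nat)
    (X : {set S}) (Y : {set T}) : bool :=
  if n is m.+1 then
    [exists t in Y, splits E m (X :&: nbh E t) Y && splits E m (X :\: nbh E t) Y]
  else X != set0.

Section Splits.
Variables (S T : finType) (E : S -> T -> bool).
Implicit Types (X : {set S}) (Y : {set T}).

Lemma splits_subset n X X' Y : X \subset X' -> splits E n X Y -> splits E n X' Y.
Proof.
elim: n X X' => [|n IHn] X X' sXX' /=.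
  by apply: contraNneq => X'0; rewrite -subset0 -X'0.
case/exists_inP => t tY /andP[h1 h2]; apply/exists_inP; exists t => //.
by rewrite (IHn _ _ (setSI _ sXX') h1) (IHn _ _ (setSD _ sXX') h2).
Qed.

Lemma splits_neq0 n X Y : splits E n X Y -> X != set0.
Proof.
elim: n X => [|n IHn] X //= /exists_inP[t _ /andP[/IHn h _]].
by apply: contraNneq h => ->; rewrite set0I.
Qed.

(* A Ramsey property of trees whose nodes are coloured by [P]. *)
Lemma splits_partition p q X Y (P : pred T) : splits E (p + q) X Y ->
  splits E p X [set t in Y | P t] || splits E q X [set t in Y | ~~ P t].
Proof.
have [m] := ubnP (p + q); elim: m p q X => // m IHm [|p] q X.
  by move=> _ /splits_neq0 /= ->.
case: q => [|q]; first by move=> _ /splits_neq0 /= ->; rewrite orbT.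
rewrite addSn ltnS => ltm /exists_inP[t tY /andP[h1 h2]].
(* If both subtrees contain a [P]-tree of height [p], the root joins them; otherwise one subtree
   already contains a tree of the other colour. *)
have [Pt|nPt] := boolP (P t).
  have /orP[s1|s1] := IHm p q.+1 _ ltm h1; last first.
    by rewrite (splits_subset _ s1) ?orbT // subsetIl.
  have /orP[s2|s2] := IHm p q.+1 _ ltm h2; last first.
    by rewrite (splits_subset _ s2) ?orbT // subsetDl.
  by apply/orP; left; apply/exists_inP; exists t;
    [rewrite inE tY Pt|by apply/andP; split].
rewrite -addSnnS in ltm h1 h2.
have /orP[s1|s1] := IHm p.+1 q _ ltm h1.
  by rewrite (splits_subset _ s1) // subsetIl.
have /orP[s2|s2] := IHm p.+1 q _ ltm h2.
  by rewrite (splits_subset _ s2) // subsetDl.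
by apply/orP; right; apply/exists_inP; exists t;
  [rewrite inE tY nPt|by apply/andP; split].
Qed.

(* [ladder true] lists pairs with [E s_i t_j] iff [i <= j], [ladder false]
   pairs with [E s_i t_j] iff [j < i]. *)
Definition ladder (b : bool) (l : seq (S * T)) : bool :=
  all (fun u => E u.1 u.2 == b) l
  && pairwise (fun u v => (E u.1 v.2 == b) && (E v.1 u.2 == ~~ b)) l.

Lemma ladderP b l (x0 : S * T) (i j : nat) : ladder b l ->
  (i < size l)%N -> (j < size l)%N ->
  E (nth x0 l i).1 (nth x0 l j).2 = (if (i <= j)%N then b else ~~ b).
Proof.
case/andP => /all_nthP hd /(pairwiseP x0) hp il jl.
have [ij|ji|->] := ltngtP i j.
- by have /andP[/eqP ->] := hp i j il jl ij.
- by have /andP[_ /eqP ->] := hp j i jl il ji.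
- exact/eqP/hd.
Qed.

Lemma ladder_cons b s t l : E s t = b ->
  (forall u, u \in l -> E s u.2 = b /\ E u.1 t = ~~ b) ->
  ladder b l -> ladder b ((s, t) :: l).
Proof.
move=> st hl /andP[h1 h2]; rewrite /ladder /= st eqxx h1 h2 !andbT /=.
by apply/allP => u /hl[-> ->]; rewrite !eqxx.
Qed.

(** Recursion of [splits_ladder]: two-colouring the nodes halves the height, and descending below
    the root costs one level. *)
Fixpoint ladder_height (n : nat) : nat :=
  if n is m.+1 then ((ladder_height m).+1 + (ladder_height m).+1)%N else 0%N.

(** Fix [s] in [X] and colour each node [t] by [E s t]. Below the root [t] of a monochromatic
    subtree, on the side where [E ^~ t] takes the opposite value, induction gives a ladder that
    [(s, t)] can extend at the front. *)
Lemma splits_ladder p q X Y : splits E (ladder_height (p + q)) X Y ->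
  exists b l, [/\ ladder b l, size l = (if b then p else q) &
    forall u, u \in l -> u.1 \in X /\ u.2 \in Y].
Proof.
have [m] := ubnP (p + q); elim: m p q X Y => // m IHm [|p] q X Y.
  by exists true, [::].
case: q => [|q]; first by exists false, [::].
rewrite addSn ltnS => ltm hs; have := splits_neq0 hs.
case/set0Pn => s sX; have := splits_partition (E s) hs.
case/orP => /exists_inP[t]; rewrite inE => /andP[tY Est] /andP[h1 h2].
- have [[] [l [hl szl inl]]] := IHm p q.+1 _ _ ltm h2.
    exists true, ((s, t) :: l); split; rewrite /= ?szl //.
      apply: ladder_cons => // u /inl; rewrite !inE => -[/andP[/negPf -> _]].
      by case/andP.
    move=> u; rewrite inE => /predU1P[-> //|/inl]; rewrite !inE.
    by case=> /andP[_ ->] /andP[-> _].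
  exists false, l; split=> // u /inl; rewrite !inE.
  by case=> /andP[_ ->] /andP[-> _].
- rewrite addnS -addSn in ltm h1; have [[] [l [hl szl inl]]] := IHm p.+1 q _ _ ltm h1.
    exists true, l; split=> // u /inl; rewrite !inE.
    by case=> /andP[-> _] /andP[-> _].
  exists false, ((s, t) :: l); split; rewrite /= ?szl //.
    apply: ladder_cons => //; first exact/negbTE.
    move=> u /inl; rewrite !inE => -[/andP[_ ->] /andP[_ /negPf ->]] //.
  move=> u; rewrite inE => /predU1P[-> //|/inl]; rewrite !inE.
  by case=> /andP[-> _] /andP[-> _].
Qed.
End Splits.

Definition add_rel (G : finZmodType) (A : {set G}) (x g : G) : bool := x + g \in A.

Lemma stable_not_splits (G : finZmodType) (k : nat) (A : {set G}) X Y :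
  stable k A -> ~~ splits (add_rel A) (ladder_height (k + k.+1)) X Y.
Proof.
move=> stA; apply/negP => /splits_ladder[b [l [hl szl _]]]; apply: stA.
case: b hl szl => hl szl.
  exists (fun i => (nth (0, 0) l i).1), (fun i => (nth (0, 0) l i).2) => i j.
  by rewrite -[_ \in A]/(add_rel A _ _) (ladderP _ hl) ?szl //; case: leqP.
(* Reversing the ladder and shifting one index turns [j < i] into [i <= j]; the shift accounts for
   the length [k.+1]. *)
exists (fun i => (nth (0, 0) l (k - i)).1).
exists (fun i => (nth (0, 0) l (k - i.+1)).2) => i j.
rewrite -[_ \in A]/(add_rel A _ _) (ladderP _ hl) ?szl; try lia.
have := ltn_ord i; have := ltn_ord j; case: (leqP (k - i) _) => /= *; split=> //; lia.
Qed.

(** * Good sets and separated families *)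

Section Counting.
Variables (R : realFieldType) (S T : finType) (E : S -> T -> bool).

Definition good (eta : R) (X : {set S}) : Prop := forall t : T,
  #|X :&: nbh E t|%:R <= eta * #|X|%:R \/ #|X :\: nbh E t|%:R <= eta * #|X|%:R.

(** If [X] is not good, some [t] cuts it into two parts of relative size above [eta i], and one of
    them admits no tree of height one less. The density after [i] cuts is tracked by [alpha i]. *)
Lemma exists_good (N : R) (alpha eta : nat -> R) (n i : nat) (X : {set S}) :
  0 < N -> (forall j, 0 < alpha j) -> (forall j, 0 <= eta j) ->
  (forall j, alpha j.+1 = alpha j * eta j) ->
  alpha i * N <= #|X|%:R -> ~~ splits E n X setT ->
  exists j (Y : {set S}), [/\ (j < i + n)%N, alpha j * N <= #|Y|%:R & good (eta j) Y].
Proof.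
move=> N_gt0 alpha_gt0 eta_ge0 alphaS.
elim: n i X => [|n IHn] i X sX /=.
  rewrite negbK => /eqP X0; move: sX; rewrite X0 cards0.
  by rewrite leNgt mulr_gt0.
move=> nspl; have [/forallP hg|] := boolP [forall t,
    (#|X :&: nbh E t|%:R <= eta i * #|X|%:R)
    || (#|X :\: nbh E t|%:R <= eta i * #|X|%:R)].
  exists i, X; split; rewrite ?addnS ?ltnS ?leq_addr // => t.
  exact/orP.
rewrite negb_forall => /existsP[t]; rewrite negb_or -!ltNge => /andP[big_in big_out].
have sub (Y : {set S}) : eta i * #|X|%:R < #|Y|%:R -> ~~ splits E n Y setT ->
    exists j (Y : {set S}),
      [/\ (j < i + n.+1)%N, alpha j * N <= #|Y|%:R & good (eta j) Y].
  move=> bigY nsY; have [|j [Z [ltj sZ gZ]]] := IHn i.+1 Y _ nsY.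
    rewrite alphaS mulrAC (le_trans _ (ltW bigY)) // mulrC.
    exact: ler_wpM2l.
  by exists j, Z; split; rewrite // addnS -addSn.
have : ~~ (splits E n (X :&: nbh E t) setT && splits E n (X :\: nbh E t) setT).
  by apply: contra nspl => hs; apply/exists_inP; exists t; rewrite ?inE.
by rewrite negb_and => /orP[]; apply: sub.
Qed.

(** Double counting of ordered pairs with the [t] that distinguish them; each cut pair occurs in
    both orders. *)
Lemma sum_cut_eq (X : {set S}) :
  (\sum_t (#|X :&: nbh E t| * #|X :\: nbh E t|).*2 =
   \sum_(s in X) \sum_(s' in X) #|[set t | E s t != E s' t]|)%N.
Proof.
under [RHS]eq_bigr do under eq_bigr do rewrite -sum1_card big_mkcond /=.
under [RHS]eq_bigr do rewrite exchange_big /=.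
rewrite exchange_big /=; apply: eq_bigr => t _.
rewrite (bigID (mem (nbh E t))) /= -addnn; congr addn.
  rewrite (eq_bigr (fun=> #|X :\: nbh E t|)) => [|s /andP[_]].
    by rewrite -sum_nat_const; apply: eq_bigl => s; rewrite !inE.
  rewrite inE => st; rewrite -sum1_card [RHS]big_mkcond [LHS]big_mkcond.
  by apply: eq_bigr => s' _; rewrite !inE st; case: (s' \in X); case: (E s' t).
rewrite (eq_bigr (fun=> #|X :&: nbh E t|)) => [|s /andP[_]].
  by rewrite mulnC -sum_nat_const; apply: eq_bigl => s; rewrite !inE andbC.
rewrite inE => /negPf st; rewrite -sum1_card [RHS]big_mkcond [LHS]big_mkcond.
by apply: eq_bigr => s' _; rewrite !inE st; case: (s' \in X); case: (E s' t).
Qed.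

(* Some [t] cuts a [delta]-separated family into two parts of relative size at
   least [delta / 4], because on average over [t] a proportion at least [delta]
   of the pairs is cut. *)
Lemma separated_splits (delta : R) (n : nat) (X : {set S}) :
  (0 < #|T|)%N -> 0 < delta -> delta <= 1 ->
  (forall s s', s \in X -> s' \in X -> s != s' ->
     delta * #|T|%:R <= #|[set t | E s t != E s' t]|%:R) ->
  1 <= #|X|%:R * (delta / 4) ^+ n -> splits E n X setT.
Proof.
move=> T_gt0 d_gt0 d_le1; elim: n X => [|n IHn] X sepX.
  rewrite expr0 mulr1 ler1n => X_gt0 /=; apply: contraTneq X_gt0 => ->.
  by rewrite cards0.
move=> sX; set m : R := #|X|%:R in sX.
have q_ge0 : 0 <= (delta / 4) ^+ n by apply: exprn_ge0; lra.
have q_le1 : (delta / 4) ^+ n <= 1 by apply: exprn_ile1; lra.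
(* From here [m / 2 <= m - 1], which pays for the diagonal pairs. *)
have m_ge2 : 2 <= m.
  rewrite ler_nat ltnNge; apply: contraTN sX => m_le1; rewrite -ltNge.
  have m_le1R : m <= 1 by rewrite lern1.
  have pow_lt1 : (delta / 4) ^+ n.+1 < 1 by rewrite exprn_ilt1 //; lra.
  by apply: le_lt_trans pow_lt1; rewrite ler_piMl // exprn_ge0 //; lra.
have [/existsP[t /andP[h1 h2]]|] := boolP [exists t,
    (m * (delta / 4) <= #|X :&: nbh E t|%:R) && (m * (delta / 4) <= #|X :\: nbh E t|%:R)].
  apply/exists_inP; exists t; rewrite ?inE //; apply/andP; split; apply: IHn.
  - by move=> s s' /setIP[sX1 _] /setIP[sX2 _]; apply: sepX.
  - by apply: le_trans sX _; rewrite exprS mulrA ler_wpM2r.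
  - by move=> s s' /setDP[sX1 _] /setDP[sX2 _]; apply: sepX.
  - by apply: le_trans sX _; rewrite exprS mulrA ler_wpM2r.
rewrite negb_exists => /forallP hsmall; exfalso.
have lower : m * (m - 1) * (delta * #|T|%:R) <=
    (\sum_(s in X) \sum_(s' in X) #|[set t | E s t != E s' t]|)%:R.
  rewrite natr_sum -mulrA {1}/m -sum1_card natr_sum mulr_suml.
  apply: ler_sum => s sX1; rewrite mul1r (bigD1 s) //= natrD natr_sum.
  have -> : m - 1 = \sum_(s' in X | s' != s) 1.
    by rewrite /m -sum1_card natr_sum (bigD1 s) //= [1 + _]addrC addrK.
  rewrite mulr_suml -[X in X <= _]add0r lerD //.
  by apply: ler_sum => s' /andP[sX2 ns]; rewrite mul1r sepX // eq_sym.
(* One part is always smaller than [m * (delta / 4)], so each [t] cuts too few ordered pairs for the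
   separation. *)
have upper : (\sum_t (#|X :&: nbh E t| * #|X :\: nbh E t|).*2)%:R
    < \sum_(t : T) (m * (m - 1) * delta).
  rewrite natr_sum; apply: ltr_sum => [|t _]; last first.
    have : #|X|%:R = #|X :&: nbh E t|%:R + #|X :\: nbh E t|%:R :> R.
      by rewrite -natrD cardsID.
    have := hsmall t; rewrite negb_and -!ltNge -/m -muln2 natrM natrM.
    move: (#|X :&: nbh E t|%:R) (ler0n R #|X :&: nbh E t|) => a a_ge0.
    move: (#|X :\: nbh E t|%:R) (ler0n R #|X :\: nbh E t|) => b b_ge0.
    move=> hab mE; have md : m * (delta / 4) * m * 2 <= m * (m - 1) * delta.
      have : 0 <= m * delta * (m - 2) by rewrite mulr_ge0 ?mulr_ge0 //; lra.
      by lra.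
    apply: lt_le_trans md; rewrite ltr_pM2r //.
    by case/orP: hab => hab; nra.
  have /card_gt0P[t _] := T_gt0.
  by apply/hasP; exists t; rewrite // mem_index_enum.
rewrite sum_cut_eq in upper.
have := le_lt_trans lower upper.
by rewrite sumr_const -[X in _ < X]mulr_natr -[X in _ < X]mulrA ltxx.
Qed.
End Counting.

(** * Characters trivial on a subgroup *)

Lemma diagonalizable_finite_order (F : numClosedFieldType) n (A : 'M[F]_n.+1) N :
  (0 < N)%N -> A ^+ N = 1 -> diagonalizable A.
Proof.
move=> N_gt0 AN; apply/diagonalizableP.
have [rs Ers] := closed_field_poly_normal ('X^N - 1 : {poly F}).
rewrite (monicP (monic_Xn_sub_1 _ N_gt0)) scale1r in Ers.
exists rs.
  by rewrite -separable_prod_XsubC -Ers separable_Xn_sub_1 // pnatr_eq0 -lt0n.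
rewrite -Ers; apply: mxminpoly_min.
by rewrite rmorphB rmorphXn /= horner_mx_X rmorph1 AN subrr.
Qed.

(** The numbers [z ^+ m - 1] for [m < N] sum to [- N%:R], so their norms cannot all be at most
    [1 / 2]. *)
Lemma root_of_unity_far (F : numClosedFieldType) (z : F) N :
  (0 < N)%N -> z ^+ N = 1 -> z != 1 -> exists m, 1 / 2 < `|z ^+ m - 1|.
Proof.
move=> N_gt0 zN z1.
have [/existsP[m hm]|] := boolP [exists m : 'I_N, 1 / 2 < `|z ^+ m - 1|].
  by exists m.
rewrite negb_exists => /forallP hm.
have : \sum_(m < N) (z ^+ m - 1) = - N%:R.
  rewrite sumrB sumr_const card_ord; have /eqP := subrX1 z N.
  by rewrite zN subrr eq_sym mulf_eq0 subr_eq0 (negPf z1) => /eqP ->; rewrite sub0r.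
move/(congr1 Num.norm); rewrite normrN normr_nat => hs.
have : N%:R <= \sum_(m < N) (1 / 2 : F).
  rewrite -hs; apply: le_trans (ler_norm_sum _ _ _) _; apply: ler_sum => m _.
  by rewrite real_leNgt ?normr_real // rpredM ?real1 // rpredV realn.
rewrite sumr_const card_ord lerMn2r eqn0Ngt N_gt0 /= ler_pdivlMr //.
by rewrite [1 * 2]mul1r lern1.
Qed.

Section Translation.
Variables (F : numClosedFieldType) (G : finZmodType).
Variables (n : nat) (e : 'I_n.+1 -> G) (e' : G -> 'I_n.+1).
Hypotheses (eK : cancel e e') (e'K : cancel e' e).

(** The regular representation, with [e] identifying indices and elements. *)
Definition translation_mx (y : G) : 'M[F]_n.+1 :=
  \matrix_(i, j) (e j == e i + y)%:R.

Lemma translation_mxM y z :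
  translation_mx y * translation_mx z = translation_mx (y + z).
Proof.
apply/matrixP => i k; rewrite -[_ * _]/(_ *m _) !mxE (bigD1 (e' (e i + y))) //=.
rewrite !mxE e'K eqxx mul1r addrA big1 ?addr0 // => j.
apply: contraNeq; rewrite !mxE; case: (e j =P _) => [<-|_]; last by rewrite mul0r eqxx.
by rewrite eK eqxx.
Qed.

Lemma translation_mx0 : translation_mx 0 = 1.
Proof.
apply/matrixP => i j; rewrite -[1]/(1%:M) !mxE addr0 eq_sym.
by rewrite (inj_eq (can_inj eK)).
Qed.

Lemma translation_mxX y m : translation_mx y ^+ m = translation_mx (y *+ m).
Proof.
elim: m => [|m IHm]; first by rewrite translation_mx0.
by rewrite exprS IHm translation_mxM mulrS.
Qed.
End Translation.

Lemma mulrn_card (G : finZmodType) (y : G) : y *+ #|G| = 0.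
Proof.
have : \sum_(x : G) x = \sum_(x : G) (x + y).
  by rewrite (reindex_inj (addIr y)).
by rewrite big_split /= sumr_const -[LHS]addr0 => /addrI.
Qed.

(* Translations commute and have finite order, hence are simultaneously
   diagonalisable; decompose the indicator of [H] in a common eigenbasis: some
   eigenvector it involves is not fixed by [x]. *)
Lemma separating_multiplicative (F : numClosedFieldType) (G : finZmodType)
    (H : {set G}) (x : G) :
  (forall h y, h \in H -> (y + h \in H) = (y \in H)) -> 0 \in H -> x \notin H ->
  exists f : G -> F, [/\ forall y z, f (y + z) = f y * f z, f 0 = 1,
    forall h, h \in H -> f h = 1 & f x != 1].
Proof.
move=> HD H0 xH; have /prednK G_gt0 : (0 < #|G|)%N by apply/card_gt0P; exists 0.
pose e (i : 'I_(#|G|.-1.+1)) : G := enum_val (cast_ord G_gt0 i).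
pose e' (g : G) : 'I_(#|G|.-1.+1) := cast_ord (esym G_gt0) (enum_rank g).
have eK : cancel e e' by move=> i; rewrite /e /e' enum_valK cast_ordK.
have e'K : cancel e' e by move=> i; rewrite /e /e' cast_ordKV enum_rankK.
pose T := translation_mx F e.
have TM y z : T y * T z = T (y + z) by apply: translation_mxM.
have [P Pu /allP hP] : codiagonalizable [seq T y | y <- enum G].
  apply/codiagonalizableP; split.
    move=> _ _ /mapP[y _ ->] /mapP[z _ ->].
    by rewrite /comm_mx -[LHS]/(T y * T z) -[RHS]/(T z * T y) !TM addrC.
  move=> _ /mapP[y _ ->]; apply: (diagonalizable_finite_order (N := #|G|)).
    by apply/card_gt0P; exists 0.
  by rewrite [LHS](translation_mxX F eK e'K) mulrn_card; apply: translation_mx0 eK.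
(* The eigenvalues of [T y]: for fixed [i], [d y 0 i] is multiplicative in [y]. *)
pose d y := \row_i (P *m T y *m invmx P) i i.
have hd y : P *m T y = diag_mx (d y) *m P.
  have /hP /similar_diagPex[D /(similarP Pu) hD] : T y \in [seq T y | y <- enum G].
    by apply: map_f; rewrite mem_enum.
  rewrite hD; congr (diag_mx _ *m _).
  by apply/rowP => i; rewrite mxE hD mulmxK // mxE eqxx.
have dM y z i : d (y + z) 0 i = d y 0 i * d z 0 i.
  have : diag_mx (d (y + z)) = diag_mx (d y) *m diag_mx (d z).
    rewrite -[LHS](mulmxK Pu) -hd -TM -[T y * T z]/(T y *m T z) mulmxA hd.
    by rewrite -[diag_mx _ *m P *m _]mulmxA hd mulmxA mulmxK.
  by rewrite mulmx_diag => /(congr1 (fun M : 'M_ _ => M i i)); rewrite !mxE eqxx.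
have d0 i : d 0 0 i = 1.
  by rewrite mxE [T 0](translation_mx0 F eK) mulmx1 mulmxV // mxE eqxx.
pose u : 'rV[F]_(#|G|.-1.+1) := \row_i (e i \in H)%:R.
have uT y j : (u *m T y) 0 j = (e j - y \in H)%:R.
  rewrite mxE (bigD1 (e' (e j - y))) //= !mxE e'K subrK eqxx mulr1 big1 ?addr0 // => i.
  apply: contraNeq; rewrite !mxE; case: (_ =P e i + y) => [->|_]; rewrite ?mulr0 ?eqxx //.
  by rewrite addrK eK eqxx.
pose c := u *m invmx P.
have cd y j : (u *m T y *m invmx P) 0 j = c 0 j * d y 0 j.
  rewrite -[u in LHS](mulmxKV Pu) -/c -[c *m P *m _]mulmxA hd !mulmxA mulmxK //.
  by rewrite mul_mx_diag mxE.
have [j /andP[cj dj]|hall] := pickP [pred j | (c 0 j != 0) && (d x 0 j != 1)].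
  exists (fun y => d y 0 j); split=> // h hH.
  apply: (mulfI cj); rewrite -cd mulr1; congr fun_of_matrix; congr (_ *m _).
  apply/rowP => i; rewrite uT mxE; congr (nat_of_bool _)%:R.
  by rewrite -[in RHS](subrK h (e i)) (HD h).
(* Otherwise [T x] fixes the indicator of [H]; its entry at [x] would then give both [x \notin H]
   and [x - x \in H]. *)
have uTx : u *m T x = u.
  rewrite -[LHS](mulmxKV Pu) -[RHS](mulmxKV Pu) -/c; congr (_ *m _).
  apply/rowP => j; rewrite cd; have /= := hall j.
  by case: eqP => [->|_]; rewrite ?mul0r //= => /negbFE/eqP->; rewrite mulr1.
have := uT x (e' x); rewrite uTx mxE e'K subrr H0 (negPf xH) => /eqP.
by rewrite eq_sym oner_eq0.
Qed.

(** The values of [f] are roots of unity, hence of modulus 1; a suitable power of [f] moves [x] far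
    from 1 and stays trivial on [H]. *)
Lemma separating_character (R : realType) (G : finZmodType) (H : {set G}) (x : G) :
  (forall h y, h \in H -> (y + h \in H) = (y \in H)) -> 0 \in H -> x \notin H ->
  exists gamma : character R G, [/\ forall y z, gamma (y + z) = gamma y * gamma z,
    forall h, h \in H -> gamma h = 1 & 1 / 2 < `|gamma x - 1|].
Proof.
move=> HD H0 xH.
have [f [fM f0 fH fx]] := separating_multiplicative R[i] HD H0 xH.
have fX y m : f (y *+ m) = f y ^+ m.
  by elim: m => [|m IHm]; rewrite ?f0 // mulrS fM IHm exprS.
have f_order y : f y ^+ #|G| = 1 by rewrite -fX mulrn_card.
have G_gt0 : (0 < #|G|)%N by apply/card_gt0P; exists 0.
have [m hm] := root_of_unity_far G_gt0 (f_order x) fx.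
have chi : is_character [ffun y => f y ^+ m].
  apply/andP; split.
    by apply/forallP=> y; apply/forallP=> z; rewrite !ffunE fM exprMn.
  apply/forallP=> y; rewrite ffunE normrX.
  have /eqP : `|f y| ^+ #|G| = 1 by rewrite -normrX f_order normr1.
  by rewrite pexprn_eq1 // eqn0Ngt G_gt0 => /eqP ->; rewrite expr1n.
exists (Character chi); split=> [y z|h hH|]; rewrite /= !ffunE //.
  by rewrite fM exprMn.
by rewrite fH ?expr1n.
Qed.

(** * Stabilisers and transversals *)

Definition periods (G : finZmodType) (D : {set G}) : {set G} :=
  [set t | [forall g, (g + t \in D) == (g \in D)]].

Section Periods.
Variables (G : finZmodType) (D : {set G}).

Lemma periodsP t : reflect (forall g, (g + t \in D) = (g \in D)) (t \in periods D).
Proof. by rewrite inE; apply: (iffP forallP) => h g; apply/eqP. Qed.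

Lemma periods0 : 0 \in periods D.
Proof. by apply/periodsP => g; rewrite addr0. Qed.

Lemma periodsD h t : h \in periods D -> (t + h \in periods D) = (t \in periods D).
Proof.
move=> /periodsP Dh; apply/periodsP/periodsP => Dt g; have := Dt g.
  by rewrite addrA Dh.
by rewrite addrA Dh.
Qed.

Lemma periodsN h : h \in periods D -> - h \in periods D.
Proof. by move=> Hh; rewrite -(periodsD _ Hh) addNr periods0. Qed.

(** Take a maximal separated set: an uncovered [x] could be added to it. *)
Lemma exists_transversal (H : {set G}) : 0 \in H -> (forall h, h \in H -> - h \in H) ->
  exists T : {set G}, (forall s t, s \in T -> t \in T -> s != t -> s - t \notin H) /\
    forall x, exists2 t, t \in T & x - t \in H.
Proof.
move=> H0 HN.
pose sep (T : {set G}) := [forall s in T, forall t in T, (s != t) ==> (s - t \notin H)].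
have sepP (T : {set G}) : reflect
    (forall s t, s \in T -> t \in T -> s != t -> s - t \notin H) (sep T).
  apply: (iffP forall_inP) => [h s t sT tT|h s sT].
    by have /forall_inP/(_ t tT)/implyP := h s sT.
  by apply/forall_inP => t tT; apply/implyP; apply: h.
have sep0 : sep set0 by apply/sepP => s t; rewrite inE.
have [T /maxsetP[/sepP sT maxT] _] := maxset_exists sep0.
exists T; split=> // x; have [/exists_inP //|] := boolP [exists t in T, x - t \in H].
rewrite negb_exists_in => /forall_inP far.
suff sepxT : sep (x |: T).
  by exists x; rewrite ?subrr // -(maxT _ sepxT (subsetUr _ _)) setU11.
apply/sepP => s t /setU1P[->|sT1] /setU1P[->|tT1] //; rewrite ?eqxx //.
- by move=> _; apply: far.
- by move=> _; apply: contra (far s sT1) => /HN; rewrite opprB.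
- exact: sT.
Qed.

End Periods.

(** * The majority set and averaging over cosets *)

Section Majority.
Variables (R : realFieldType) (G : finZmodType) (A X : {set G}) (eta : R).
Hypotheses (eta_small : eta <= 1 / 4) (X_gt0 : (0 < #|X|)%N).
Hypothesis goodX : good (add_rel A) eta X.

Definition majority : {set G} :=
  [set g | #|X :\: nbh (add_rel A) g|%:R <= eta * #|X|%:R].

Lemma majorityPn g : g \notin majority ->
  #|X :&: nbh (add_rel A) g|%:R <= eta * #|X|%:R.
Proof. by rewrite inE => /negPf maj; case: (goodX g); rewrite ?maj. Qed.

(** [X] is covered by two exceptional sets of size at most a quarter of it and the set where the
    translates differ. *)
Lemma majority_neq u v : u \in majority -> v \notin majority ->
  #|X|%:R / 2 <= #|[set x in X | (x + u \in A) != (x + v \in A)]|%:R :> R.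
Proof.
move=> uD /majorityPn hv; have {uD} hu : #|X :\: nbh (add_rel A) u|%:R <= eta * #|X|%:R.
  by move: uD; rewrite inE.
set W := [set x in X | _].
have : (#|X| <= #|X :\: nbh (add_rel A) u| + #|X :&: nbh (add_rel A) v| + #|W|)%N.
  have sub : X \subset (X :\: nbh (add_rel A) u) :|: (X :&: nbh (add_rel A) v) :|: W.
    apply/subsetP => x xX; rewrite !inE /add_rel xX /=.
    by case: (x + u \in A); case: (x + v \in A).
  apply: leq_trans (subset_leq_card sub) _; apply: leq_trans (leq_card_setU _ _) _.
  by rewrite leq_add2r leq_card_setU.
rewrite -(ler_nat R) !natrD.
have : eta * #|X|%:R <= 1 / 4 * #|X|%:R by rewrite ler_wpM2r.
lra.
Qed.

Lemma separated_nonperiods s t : s - t \notin periods majority ->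
  #|X|%:R / 2 <= #|[set y | add_rel A s y != add_rel A t y]|%:R :> R.
Proof.
move=> nper; have [g hg] : exists g, (g + (s - t) \in majority) != (g \in majority).
  by apply/existsP; rewrite -negb_forall; rewrite inE in nper.
apply: (@le_trans _ _ #|[set x in X | (x + (g + (s - t)) \in A) != (x + g \in A)]|%:R).
  have [uD|uD] := boolP (g + (s - t) \in majority).
    by apply: majority_neq => //; move: hg; rewrite uD; case: (g \in _).
  under eq_finset do rewrite eq_sym.
  by apply: majority_neq => //; move: hg; rewrite (negPf uD); case: (g \in _).
(* With [y = x + (g - t)], the points compared become [s + y] and [t + y]. *)
rewrite ler_nat -(card_imset _ (addIr (g - t))); apply: subset_leq_card.
apply/subsetP => _ /imsetP[x + ->]; rewrite !inE /add_rel => /andP[_].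
by rewrite [s + (x + _)](AC (1*(1*2)) (2*(3*(1*4))))
  [t + (x + _)](AC (1*(1*2)) (2*3*(1*4))) /= subrr addr0.
Qed.

Lemma card_transversal_bound (alpha : R) (h : nat) (T : {set G}) :
  0 < alpha -> alpha * #|G|%:R <= #|X|%:R ->
  (forall s t, s \in T -> t \in T -> s != t -> s - t \notin periods majority) ->
  ~~ splits (add_rel A) h T setT -> #|T|%:R * (alpha / 8) ^+ h < 1.
Proof.
move=> a_gt0 aX sepT; rewrite ltNge; apply: contra => big.
have G_gt0 : (0 < #|G|)%N by apply: leq_trans X_gt0 (max_card _).
apply: (@separated_splits R _ _ _ (alpha / 2)) => //; rewrite ?divr_gt0 //.
- have : #|X|%:R <= #|G|%:R :> R by rewrite ler_nat max_card.
  have : 0 < #|G|%:R :> R by rewrite ltr0n.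
  by nra.
- move=> s t sT tT /(sepT _ _ sT tT) /separated_nonperiods; apply: le_trans.
  by lra.
- by rewrite -mulrA -invfM -natrM.
Qed.

End Majority.

(* Counting the pairs [(x, h)] with [x + (g - c + h) \in P] in two ways. *)
Lemma coset_average (R : realFieldType) (G : finZmodType) (H P X : {set G})
    (c g : G) (kappa : R) :
  (forall h y, h \in H -> (y + h \in H) = (y \in H)) ->
  (0 < #|X|)%N -> (forall x, x \in X -> x - c \in H) ->
  (forall h, h \in H -> #|[set x in X | x + (g - c + h) \in P]|%:R <= kappa * #|X|%:R) ->
  #|[set h in H | h + g \in P]|%:R <= kappa * #|H|%:R.
Proof.
move=> HD X_gt0 Xc small.
(* Since [x - c] lies in [H], adding it permutes [H], so the count is independent of [x]. *)
have fiber x : x \in X ->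
    #|[set h in H | x + (g - c + h) \in P]| = #|[set h in H | h + g \in P]|.
  move=> xX; rewrite -(card_imset _ (addIr (x - c))); apply: eq_card => y.
  have shift t : x + (g - c + t) = t + (x - c) + g.
    by rewrite [RHS](AC (1*2*1) (2*(4*3*1))).
  apply/imsetP/idP => [[t + ->]|].
    by rewrite !inE shift HD ?Xc.
  rewrite inE => /andP[yH yP]; exists (y - (x - c)); last by rewrite subrK.
  by rewrite inE shift subrK yP -(HD (x - c)) ?Xc // subrK yH.
have dbl : (\sum_(h in H) #|[set x in X | (x + (g - c + h))%R \in P]| =
    #|X| * #|[set h in H | (h + g)%R \in P]|)%N.
  rewrite -sum_nat_const -(eq_bigr _ fiber).
  under eq_bigr do rewrite -sum1dep_card big_mkcondr /=.
  under [RHS]eq_bigr do rewrite -sum1dep_card big_mkcondr /=.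
  exact: exchange_big.
have X0 : 0 < #|X|%:R :> R by rewrite ltr0n.
rewrite -(ler_pM2l X0) -natrM -dbl natr_sum mulrA [_ * kappa]mulrC.
by rewrite mulr_natr -sumr_const; apply: ler_sum => h; apply: small.
Qed.

(** Pigeonhole, with [c] maximal over all of [G] and [0] as default witness. *)
Lemma exists_popular_coset (G : finZmodType) (H T X : {set G}) :
  (0 < #|X|)%N -> (forall x, exists2 t, t \in T & x - t \in H) ->
  exists c, (#|X| <= #|T| * #|[set x in X | (x - c \in H)%R]|)%N.
Proof.
move=> X_gt0 cover.
pose f t := #|[set x in X | x - t \in H]|; pose c := [arg max_(t > 0) f t].
exists c; rewrite -sum_nat_const.
apply: (@leq_trans (\sum_(t in T) f t)); last first.
  by apply: leq_sum => t _; rewrite /c; case: arg_maxnP => // t0 _; apply.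
under eq_bigr do rewrite /f -sum1dep_card big_mkcondr /=.
rewrite exchange_big -sum1_card; apply: leq_sum => x _ /=.
by have [t tT xt] := cover x; rewrite (bigD1 t) //= xt.
Qed.

(* The density of the good set found after [i] splittings is at least
   [eps ^+ level h i]. *)
Fixpoint level (h i : nat) : nat :=
  if i is j.+1 then ((2 + 3 * h + h * level h j) + level h j)%N else 0%N.

Lemma level_mono h : {homo level h : i j / (i <= j)%N}.
Proof. by apply: homo_leq (leqnn) leq_trans _ => i /=; rewrite leq_addl. Qed.

Lemma stable_subgroup (R : realFieldType) (G : finZmodType) (A : {set G})
    (h : nat) (eps : R) :
  0 < eps -> eps < 1 / 2 -> (forall X Y, ~~ splits (add_rel A) h X Y) ->
  exists H T : {set G}, [/\ 0 \in H,
    forall t y, t \in H -> (y + t \in H) = (y \in H),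
    forall x, exists2 t, t \in T & x - t \in H,
    #|T|%:R <= eps ^- ((3 + level h h) * h) &
    forall g, #|[set t in H | t + g \in A]|%:R <= eps * #|H|%:R \/
              #|[set t in H | t + g \notin A]|%:R <= eps * #|H|%:R].
Proof.
move=> e_gt0 e_lt nspl.
have G_gt0 : (0 < #|G|)%N by apply/card_gt0P; exists 0.
pose alpha i := eps ^+ level h i.
(* The factor [eps ^+ ((3 + level h i) * h)] absorbs [#|T|]; the remaining [eps ^+ 2] gives
   [eta i <= 1 / 4] and the final error [eps]. *)
pose eta i := eps ^+ (2 + 3 * h + h * level h i).
have alphaS i : alpha i.+1 = alpha i * eta i by rewrite -exprD addnC.
have alpha_gt0 i : 0 < alpha i by apply: exprn_gt0.
have eta_ge0 i : 0 <= eta i by apply/ltW/exprn_gt0.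
have [||i [X [lti aX gX]]] := exists_good (i := 0) (N := #|G|%:R) (X := setT)
    _ alpha_gt0 eta_ge0 alphaS _ (nspl setT setT).
- by rewrite ltr0n.
- by rewrite /alpha expr0 mul1r cardsT.
have X_gt0 : (0 < #|X|)%N.
  rewrite -(ltr0n R); apply: lt_le_trans aX.
  by rewrite mulr_gt0 ?ltr0n.
have e_le1 : eps <= 1 by lra.
have eta_small : eta i <= 1 / 4.
  apply: (@le_trans _ _ (eps ^+ 2)); last by rewrite expr2; nra.
  by apply: ler_wiXn2l; rewrite ?(ltW e_gt0) // -addnA leq_addr.
pose D := majority A X (eta i); pose H := periods D.
have H0 : 0 \in H by apply: periods0.
have HD t y : t \in H -> (y + t \in H) = (y \in H) by apply: periodsD.
have [T [sepT coverT]] := exists_transversal H0 (@periodsN _ D).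
(* Lets [alpha i / 8] be bounded below by a power of [eps]. *)
have e3 : eps ^+ 3 <= 1 / 8.
  by rewrite (_ : 1 / 8 = (1 / 2) ^+ 3); [apply: lerXn2r; rewrite ?nnegrE; lra |
    rewrite expr_div_n expr1n -natrX].
have cardT : #|T|%:R * eps ^+ ((3 + level h i) * h) < 1.
  have := card_transversal_bound eta_small X_gt0 gX (alpha_gt0 i) aX sepT (nspl _ _).
  apply: le_lt_trans.
  rewrite ler_wpM2l // exprM; apply: lerXn2r; rewrite ?nnegrE.
  - exact/exprn_ge0/ltW.
  - by rewrite divr_ge0 // ltW.
  - by rewrite exprD mulrC ler_wpM2l ?(ltW (alpha_gt0 _)) // -[8^-1]mul1r.
exists H, T; split=> //.
  rewrite -[X in _ <= X]mul1r ler_pdivlMr ?exprn_gt0 // (le_trans _ (ltW cardT)) //.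
  rewrite ler_wpM2l // ler_wiXn2l ?(ltW e_gt0) // leq_mul2r leq_add2l.
  by rewrite level_mono ?orbT // ltnW.
have [c popular] := exists_popular_coset X_gt0 coverT.
set X' := [set x in X | _] in popular.
have X'_gt0 : (0 < #|X'|)%N.
  by move: (leq_trans X_gt0 popular); rewrite muln_gt0 => /andP[].
have X'c x : x \in X' -> x - c \in H by rewrite inE => /andP[].
have small : eta i * #|X|%:R <= eps * #|X'|%:R.
  apply: (@le_trans _ _ (eta i * (#|T|%:R * #|X'|%:R))).
    by rewrite ler_wpM2l // -natrM ler_nat.
  rewrite mulrA ler_wpM2r // mulrC.
  rewrite (_ : eta i = eps * (eps * eps ^+ ((3 + level h i) * h))).
    rewrite !mulrA [_ * eps]mulrC -!mulrA ler_piMr ?(ltW e_gt0) //.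
    by rewrite mulrCA mulr_ile1 ?mulr_ge0 ?exprn_ge0 ?(ltW e_gt0) ?(ltW cardT).
  by rewrite -!exprS; congr (_ ^+ _); lia.
(* [D] is invariant under [H], so the whole coset of [g - c] lies in [D] or misses it. *)
move=> g; have [gD|gD] := boolP (g - c \in D); [right|left].
  have -> : [set t in H | t + g \notin A] = [set t in H | t + g \in ~: A].
    by apply/setP => t; rewrite !inE.
  apply: (@coset_average R G H _ X' c g eps HD X'_gt0 X'c) => t tH.
  apply: le_trans small.
  have : g - c + t \in D by move/periodsP: tH => ->.
  rewrite inE; apply: le_trans; rewrite ler_nat; apply: subset_leq_card.
  by apply/subsetP => x; rewrite !inE => /andP[/andP[-> _] ->].
apply: (@coset_average R G H A X' c g eps HD X'_gt0 X'c) => t tH.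
have tD : g - c + t \notin D by move/periodsP: tH => ->.
apply: le_trans small; apply: le_trans (majorityPn gX tD).
rewrite ler_nat; apply: subset_leq_card.
by apply/subsetP => x; rewrite !inE /add_rel => /andP[/andP[-> _] ->].
Qed.

(** * Realisation as a Bohr set *)

(** Each [t] in [T] outside [H] contributes a character trivial on [H] and far from 1 at [t], hence
    far from 1 on the whole coset of [t]. *)
Lemma bohr_subgroup (R : realType) (G : finZmodType) (H T : {set G}) :
  0 \in H -> (forall t y, t \in H -> (y + t \in H) = (y \in H)) ->
  (forall x, exists2 t, t \in T & x - t \in H) ->
  exists K : {fset character R G}, (#|` K| <= #|T|)%N /\ bohr K (1 / 2) = H.
Proof.
move=> H0 HD cover.
have [chi hchi] : exists chi : G -> character R G, forall x, x \notin H ->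
    [/\ forall y z, chi x (y + z) = chi x y * chi x z,
        forall h, h \in H -> chi x h = 1 & 1 / 2 < `|chi x x - 1|].
  apply: (@fin_all_exists G (fun=> character R G) (fun x gamma => x \notin H ->
    [/\ forall y z, gamma (y + z) = gamma y * gamma z,
        forall h, h \in H -> gamma h = 1 & 1 / 2 < `|gamma x - 1|])) => x.
  have [xH|xH] := boolP (x \in H); last first.
    by have [gamma hg] := separating_character R HD H0 xH; exists gamma.
  (* Placeholder value of [chi] at points of [H]. *)
  have one : @is_character R G [ffun=> 1].
    apply/andP; split; last by apply/forallP => y; rewrite ffunE normr1.
    by apply/forallP => y; apply/forallP => z; rewrite !ffunE mulr1.
  by exists (Character one).
pose s := [seq chi t | t <- enum (T :\: H)]; exists [fset gamma in s]%fset; split.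
  rewrite card_fseq (leq_trans (size_undup _)) // size_map -cardE.
  exact/subset_leq_card/subsetDl.
apply/setP => x; rewrite inE; apply/forallP/idP => [hx|xH gamma].
  apply: contraT => xH; have [t tT xt] := cover x.
  have tH : t \notin H by apply: contra xH => tH; rewrite -[x](subrK t) addrC HD.
  have tK : chi t \in [fset gamma in s]%fset.
    by rewrite in_fset; apply/map_f; rewrite mem_enum inE tH.
  have := hx [` tK]%fset; have [chiM chi1 far] := hchi t tH.
  rewrite /= -[x](subrK t) chiM chi1 // mul1r => /(lt_le_trans far).
  by rewrite rmorphM rmorph1 fmorphV rmorph_nat ltxx.
have := valP gamma; rewrite in_fset => /mapP[t].
rewrite mem_enum inE => /andP[tH _] ->; have [_ chi1 _] := hchi t tH.
by rewrite chi1 // subrr normr0 ler0c; lra.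
Qed.

Theorem theorem3 (R : realType) (k : nat) (hk : (2 <= k)%N) :
  exists C : R, 0 < C /\
  forall eps : R, 0 < eps -> eps < 1 ->
  exists N0 : nat,
  forall (G : finZmodType) (A : {set G}),
    (N0 <= #|G|)%N -> stable k A ->
    exists (K : {fset character R G}) (rho : R),
      [/\ 0 <= rho <= 1, eps `^ C <= rho, (#|` K|)%:R <= eps `^ (- C) &
      forall g : G,
        #|translate A g :&: bohr K rho|%:R <= eps * #|bohr K rho|%:R
        \/ #|bohr K rho :\: translate A g|%:R <= eps * #|bohr K rho|%:R].
Proof.
(* The successor makes the exponent positive and gives [eps ^+ m <= eps], which is below the width
   [1 / 2] in the main case. *)
pose h := ladder_height (k + k.+1); pose m := ((3 + level h h) * h).+1.
exists m%:R; split; first by rewrite ltr0n.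
move=> eps e_gt0 e_lt1; exists 0%N => G A _ stA.
have [e_ge|e_lt] := leP (1 / 2) eps.
  (* For [eps] at least [1 / 2] the Bohr set [G] works: a set or its complement has at most half the
     points. *)
  exists fset0, 1; split.
  - by rewrite ler01 lexx.
  - by rewrite powR_mulrn ?(ltW e_gt0) // exprn_ile1 ?(ltW e_gt0) ?(ltW e_lt1).
  - by rewrite cardfs0 powR_ge0.
  have -> : bohr (@fset0 (character R G)) 1 = setT.
    by apply/setP => x; rewrite !inE; apply/forallP => -[].
  move=> g; rewrite setIT.
  have := cardsC (translate A g); rewrite -setTD -cardsT.
  move=> /(congr1 (fun n => n%:R : R)); rewrite natrD.
  move: (#|translate A g|%:R) (ler0n R #|translate A g|) => a a_ge0.
  move: (#|_ :\: _|%:R) (ler0n R #|[set: G] :\: translate A g|) => b b_ge0 <-.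
  by have [ab|ba] := leP a b; [left|right]; nra.
have nspl X Y := stable_not_splits X Y stA.
have [H [T [H0 HD cover cardT dicho]]] := stable_subgroup e_gt0 e_lt nspl.
have [K [cardK bohrK]] := bohr_subgroup R H0 HD cover.
have half_ge : eps ^+ m <= 1 / 2.
  apply: le_trans (ltW e_lt); rewrite -[X in _ <= X]expr1.
  by apply: ler_wiXn2l; rewrite ?ltW.
exists K, (1 / 2); split.
- by apply/andP; split; lra.
- by rewrite powR_mulrn ?(ltW e_gt0).
- rewrite powRN powR_mulrn ?(ltW e_gt0) //.
  apply: (@le_trans _ _ #|T|%:R); first by rewrite ler_nat.
  apply: le_trans cardT _; rewrite lef_pV2 ?posrE ?exprn_gt0 //.
  by rewrite exprS ler_piMl ?ltW // exprn_gt0.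
move=> g; rewrite bohrK.
have mem_translate x : (x \in translate A g) = (x + g \in A).
  apply/imsetP/idP => [[a aA ->]|xA]; first by rewrite subrK.
  by exists (x + g); rewrite ?addrK.
have -> : translate A g :&: H = [set t in H | t + g \in A].
  by apply/setP => x; rewrite !inE mem_translate andbC.
have -> : H :\: translate A g = [set t in H | t + g \notin A].
  by apply/setP => x; rewrite !inE mem_translate andbC.
exact: dicho.
Qed.
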